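(* For every positive integer $n$ there exist a set $S\subseteq\{0,1\}^n$ and a matrix $W\in\{0,1\}^{2\times n}$ such that the projection $\{Wx : x\in{\rm conv}(S)\}\subset\mathbb{R}^2$ of ${\rm conv}(S)$ by $W$ into the plane has more than $\sqrt{\tfrac12 n}$ vertices. *)

(* Defs.v *)
From mathcomp Require Import all_boot all_order all_algebra finmap.
From mathcomp Require Import boolp classical_sets cardinality reals convex.

Set Implicit Arguments.
Unset Strict Implicit.
Unset Printing Implicit Defensive.

Import Order.TTheory GRing.Theory Num.Theory.

Local Open Scope classical_set_scope.
Local Open Scope ring_scope.

Definition zero_one_mx (R : realType) (m n : nat) : set 'M[R]_(m, n) :=
  [set A | forall i j, A i j = 0 \/ A i j = 1].

Definition conv_hull (R : realType) (n : nat) (S : set 'cV[R]_n) :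
    set 'cV[R]_n :=
  smallest (@convex_set R 'cV[R]_n) S.

Definition face (R : realType) (n : nat) (c : 'rV[R]_n) (P : set 'cV[R]_n) :
    set 'cV[R]_n :=
  [set v | P v /\ forall x, P x -> (c *m x) 0 0 <= (c *m v) 0 0].

(* Meant for polytopes: a vertex is a point that is by itself a face. *)
Definition vertices (R : realType) (n : nat) (P : set 'cV[R]_n) :
    set 'cV[R]_n :=
  [set v | exists c : 'rV[R]_n, face c P = [set v]].

(* Main.v *)
(* Let m be maximal with m + m^2 <= n.  The points (i, i^2), 0 <= i <= m, lie on
   a parabola, hence are all vertices of their convex hull, and each of them is
   the projection of a 0/1 vector whose ones are i of the first m coordinates
   and i^2 of the remaining ones.  By maximality
   n < (m + 1)(m + 2) <= 2 (m + 1)^2, so m + 1 > sqrt (n / 2). *)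
Require Import Defs.
From mathcomp Require Import all_boot all_order all_algebra finmap.
From mathcomp Require Import boolp classical_sets cardinality reals convex.
From mathcomp Require Import zify ring lra.

Import Order.TTheory GRing.Theory Num.Theory.

Local Open Scope classical_set_scope.
Local Open Scope ring_scope.

Section ConvHull.
Variables (R : realType) (n : nat).
Implicit Types (S A : set 'cV[R]_n).

Lemma sub_conv_hull S : S `<=` conv_hull S.
Proof. exact: sub_gen_smallest. Qed.

(** Induction principle for the hull. Both weights may be taken positive because the endpoint
    combinations are trivial; this positivity is what later keeps strict inequalities strict. *)
Lemma conv_hull_sub S A :
  (forall x y (s t : R), A x -> A y -> 0 < s -> 0 < t -> s + t = 1 ->
     A (s *: x + t *: y)) ->
  S `<=` A -> conv_hull S `<=` A.
Proof.
move=> cA; apply: smallest_sub; apply/convex_setW => x y xA yA k k0 k1.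
apply/mem_set; apply: cA => //; [exact: set_mem|exact: set_mem| |].
- by rewrite subr_gt0.
- by rewrite addrC subrK.
Qed.

Lemma mulmx_row_comb (c : 'rV[R]_n) (x y : 'cV[R]_n) (s t : R) :
  (c *m (s *: x + t *: y)) 0 0 = s * (c *m x) 0 0 + t * (c *m y) 0 0.
Proof. by rewrite mulmxDr -!scalemxAr !mxE. Qed.

End ConvHull.

Section Projection.
Variables (R : realType) (k n : nat) (W : 'M[R]_(k, n)) (S : set 'cV[R]_n).
Let P := [set W *m x | x in conv_hull S].

Lemma image_conv_hull_le (c : 'rV[R]_k) (M : R) :
  (forall x, S x -> (c *m (W *m x)) 0 0 <= M) ->
  forall v, P v -> (c *m v) 0 0 <= M.
Proof.
move=> SM _ [x Sx <-]; move: x Sx.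
apply: (@conv_hull_sub _ _ _ [set x | (c *m (W *m x)) 0 0 <= M]) => //.
move=> x y s t /= xM yM s0 t0 st.
rewrite mulmxDr -!scalemxAr mulmx_row_comb; nra.
Qed.

(** The dichotomy assumed on [S] cuts out a convex set, so it passes to the whole hull; hence [c] is
    maximal on [P] at [W *m x0] only. *)
Lemma exposed_image_vertex (c : 'rV[R]_k) (x0 : 'cV[R]_n) :
  S x0 ->
  (forall x, S x -> W *m x = W *m x0 \/
     (c *m (W *m x)) 0 0 < (c *m (W *m x0)) 0 0) ->
  vertices P (W *m x0).
Proof.
move=> Sx0 Sc.
pose A := [set x | W *m x = W *m x0 \/
                   (c *m (W *m x)) 0 0 < (c *m (W *m x0)) 0 0].
have SA : conv_hull S `<=` A.
  apply: conv_hull_sub => // x y s t Ax Ay s0 t0 st.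
  rewrite /A /= mulmxDr -!scalemxAr mulmx_row_comb.
  (* As [s] and [t] are positive, one strict inequality makes the combination strict; equality is
     left only when both points project to [W *m x0]. *)
  case: Ax => [->|xlt]; case: Ay => [->|ylt];
    [left|right; nra..].
  by rewrite -scalerDl st scale1r.
have Px0 : P (W *m x0) by exists x0 => //; exact: sub_conv_hull.
exists c; apply/seteqP; split => [v [[x /SA Ax <-] xmax]|_ ->].
  case: Ax => // xlt; have := xmax _ Px0; lra.
by split=> // _ [x /SA [->|/ltW xle] <-].
Qed.

End Projection.

(** Over finitely many generators [c] has a maximiser, which stays maximal on the projected hull.
    Its image thus lies in the face of [c], which is the single point [v]. *)
Lemma vertices_image_conv_hull_range (R : realType) (k n : nat)
    (W : 'M[R]_(k, n)) (I : finType) (i0 : I) (x : I -> 'cV[R]_n) :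
  vertices [set W *m y | y in conv_hull (range x)]
    `<=` range (fun i => W *m x i).
Proof.
move=> v [c cv].
have [i _ imax] := @arg_maxP _ _ _ i0 xpredT
  (fun i => (c *m (W *m x i)) 0 0) isT.
exists i => //.
suff : face c [set W *m y | y in conv_hull (range x)] (W *m x i).
  by rewrite cv.
split; first by exists (x i) => //; apply: sub_conv_hull; exists i.
apply: image_conv_hull_le => _ [j _ <-]; exact: imax.
Qed.

(** Serves to count the ones of a 0/1 vector within a block of coordinates. *)
Lemma sum_ord_interval (R : pzSemiRingType) (n a b : nat) :
  (b <= n)%N -> \sum_(j < n) (a <= j < b)%:R = (b - a)%:R :> R.
Proof.
move=> bn; rewrite -natr_sum; congr _%:R.
rewrite -(big_mkord xpredT (fun j => (a <= j < b)%N : nat)).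
have := sum_nat_const_nat a b 1.
rewrite (big_nat_widenl _ 0)// (big_nat_widen _ _ _ _ _ bn) big_mkcond muln1.
by move=> <-; apply: eq_bigr => j _; case: ifP.
Qed.

Lemma pronic_floor (n : nat) :
  exists m, (m + m ^ 2 <= n < m.+1 + m.+1 ^ 2)%N.
Proof.
elim: n => [|n [m /andP[mn nm]]]; first by exists 0.
case: (ltnP n.+1 (m.+1 + m.+1 ^ 2)) => h.
  by exists m; rewrite h ltnW.
by exists m.+1; rewrite h /=; lia.
Qed.

Theorem theorem3p1 (R : realType) (n : nat) (hn : (0 < n)%N) :
  exists (S : set 'cV[R]_n) (W : 'M[R]_(2, n)),
    [/\ S `<=` @zero_one_mx R n 1,
        @zero_one_mx R 2 n W,
        finite_set (vertices [set W *m x | x in conv_hull S])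
      & Num.sqrt (2^-1 * n%:R) <
        (#|` fset_set (vertices [set W *m x | x in conv_hull S])|)%:R :> R].
Proof.
have [m /andP[mn nm]] := pronic_floor n.
pose x (i : 'I_m.+1) : 'cV[R]_n :=
  \col_j ((0 <= j < i) || (m <= j < m + i ^ 2))%N%:R.
(* The rows are the indicators of the two blocks, split at [m]. Since [i <= m], the two runs of ones
   in [x i] fall into separate blocks. *)
pose W : 'M[R]_(2, n) := \matrix_(k, j) (if k == 0 then (j < m)%N else (m <= j)%N)%:R.
pose p (i : 'I_m.+1) := W *m x i.
have p0 i : p i 0 0 = i%:R.
  rewrite -[X in X%:R]subn0 -(@sum_ord_interval _ n); last by case: i => i /=; lia.
  rewrite mxE; apply: eq_bigr => j _; rewrite !mxE /= -natrM mulnb.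
  by congr (nat_of_bool _)%:R; case: i => i /= ?; lia.
have p1 i : p i 1 0 = i%:R ^+ 2.
  have im : (i ^ 2 <= m ^ 2)%N by rewrite leq_exp2r//; case: i.
  rewrite -natrX -[X in X%:R](addKn m) -(@sum_ord_interval _ n); last by lia.
  rewrite mxE; apply: eq_bigr => j _; rewrite !mxE /= -natrM mulnb.
  by congr (nat_of_bool _)%:R; case: i im => i /= *; lia.
have pinj : injective p.
  move=> i j /(congr1 (fun v : 'cV[R]_2 => v 0 0)); rewrite !p0 => /eqP.
  by rewrite eqr_nat => /eqP/val_inj.
have vE : vertices [set W *m y | y in conv_hull (range x)] = range p.
  apply/seteqP; split; first exact: (@vertices_image_conv_hull_range _ _ _ W _ ord0 x).
  move=> _ [i _ <-].
  (* A normal to the parabola at [(i, i^2)]: its value at [(j, j^2)] is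
     [2ij - j^2 = i^2 - (i - j)^2], maximal only for [j = i]. *)
  pose c : 'rV[R]_2 := \row_k (if k == 0 then i%:R *+ 2 else -1).
  have cE v : (c *m v) 0 0 = i%:R *+ 2 * v 0 0 - v 1 0.
    by rewrite mxE big_ord_recl big_ord1 !mxE /= mulN1r;
      congr (_ - v _ _); apply/val_inj.
  apply: (@exposed_image_vertex _ _ _ _ _ c); first by exists i.
  move=> _ [j _ <-]; have [->|ji] := eqVneq j i; [by left|right].
  rewrite !cE -/(p i) -/(p j) !p0 !p1 -subr_gt0.
  suff : 0 < (i%:R - j%:R) ^+ 2 :> R by congr (0 < _); ring.
  by rewrite exprn_even_gt0//= subr_eq0 eqr_nat eq_sym.
exists (range x), W; split.
- by move=> _ [i _ <-] j l; rewrite mxE; case: (_ || _); [right|left].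
- by move=> k j; rewrite mxE; case: ifP => _; case: leqP; by [left|right].
- by rewrite vE; exact: finite_image.
- have -> : #|` fset_set (vertices [set W *m y | y in conv_hull (range x)])| = m.+1.
    rewrite vE; apply: card_fset_set.
    by rewrite (card_eqr card_II); apply: inj_card_eq => i j _ _; exact: pinj.
  (* Writing [m.+1] as the root of its square reduces the bound to [n < 2 (m + 1)^2] in [nat], which
     follows from [nm]. *)
  rewrite -[ltRHS]ger0_norm// -sqrtr_sqr ltr_sqrt ?exprn_gt0//.
  rewrite -natrX mulrC ltr_pdivrMr// -natrM ltr_nat; lia.
Qed.
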